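(* Let $G$ be a finite group. Then there exists a finite group $N$ such that: (1) $G \cong \operatorname{Out}(N)$; (2) $Z(N) = 1$; (3) the only subgroup of $\operatorname{Aut}(N)$ isomorphic to $N$ is $\operatorname{Inn}(N)$; (4) there is a group homomorphism $s \colon \operatorname{Out}(N) \to \operatorname{Aut}(N)$ with $q \circ s = \mathrm{id}_{\operatorname{Out}(N)}$, where $q \colon \operatorname{Aut}(N) \to \operatorname{Out}(N)$ is the quotient map; (5) $N$ is supersolvable.
   Context: $\operatorname{Aut}(N)$ is the automorphism group of $N$, $\operatorname{Inn}(N)$ its subgroup of inner automorphisms, $\operatorname{Out}(N) = \operatorname{Aut}(N)/\operatorname{Inn}(N)$, and $Z(N)$ the center of $N$. *)

(* Defs.v *)
From HB Require Import structures.
From mathcomp Require Import all_boot all_fingroup all_solvable.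
Set Implicit Arguments. Unset Strict Implicit. Unset Printing Implicit Defensive.
Local Open Scope group_scope.

Definition Inn (gT : finGroupType) (N : {group gT}) : {group {perm gT}} :=
  (conj_aut N @* N)%G.

(* Out(N) = Aut(N) / Inn(N) is the quotient (Aut N / Inn N) in coset_of (Inn N). *)

Definition supersolvable (gT : finGroupType) (N : {group gT}) : Prop :=
  exists s : seq {group gT},
    [/\ path (fun H K : {group gT} => (H \subset K) && cyclic (K / H)) 1%G s,
        last 1%G s = N
      & all (fun H : {group gT} => H <| N) s].

(* Main.v *)
(** The group [N] is [U] extended by a torus [T] = [V -> F_p^x], where [V] is the
    vertex set of a finite graph with automorphism group [G] and [U] is the
    group of class 2 and exponent [p] generated by elements [x_v], with
    [x_u] and [x_v] commuting unless [uv] is an edge; [T] scales the [x_v]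
    independently.  An automorphism of [N] preserves the Sylow subgroup [U] and,
    by Schur-Zassenhaus, can be corrected by an inner one so as to preserve [T].
    It then permutes the weights of [T] on [U / U'], that is the lines of the
    [x_v], and after a correction by an element of [T] it is the relabelling of
    [N] by a graph automorphism.  So [Aut N] is [Inn N] extended by the
    complement [G].

    Choose a prime [l > |G|] and a prime [p] dividing [2^l - 1], so that
    [p > l] and [2] has order [l] in [F_p^x].  If [H <= Aut N] is isomorphic
    to [N], it contains the normal Hall [{p,l}]-subgroup of [Inn N], and [H'] is
    a [p]-group; hence [H] centralizes the [l]-torsion of [T] modulo [U], which
    no nontrivial relabelling does. *)
Require Import Defs.
From HB Require Import structures.
From mathcomp Require Import all_boot all_fingroup all_solvable.
From mathcomp Require Import all_algebra ring zify.
Set Implicit Arguments. Unset Strict Implicit. Unset Printing Implicit Defensive.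
Import GroupScope GRing.Theory.
Local Open Scope group_scope.

(** * Hall cores and cyclic series *)

(** A Hall [pi]-subgroup contains every normal [pi]-subgroup, in particular
    [G^](1)[, and a subgroup containing]G^[(1)] is normal. *)
Lemma Hall_pcore_of_der1 (gT : finGroupType) (pi : nat_pred) (G : {group gT}) :
  solvable G -> pi.-group G^`(1) -> pi.-Hall(G) 'O_pi(G).
Proof.
move=> solG piG'; have [H hallH] := Hall_exists pi solG.
have sHG := pHall_sub hallH.
have nHG : H <| G.
  apply: sub_der1_normal => //; apply: subset_trans (pcore_sub_Hall hallH).
  exact: pcore_max piG' (der_normal 1 G).
by rewrite (normal_Hall_pcore hallH nHG).
Qed.

(* Both cores are normal Hall subgroups of the same order, and that of [I] is a
   normal Hall subgroup of [A]. *)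
Lemma pcore_sub_isog (gT : finGroupType) (pi : nat_pred) (A I H : {group gT}) :
  solvable I -> pi.-group I^`(1) -> I <| A -> pi^'.-nat #|A : I| ->
  H \subset A -> H \isog I -> 'O_pi(I) = 'O_pi(H).
Proof.
move=> solI piI' nIA piAI sHA HI.
have hallI := Hall_pcore_of_der1 solI piI'.
have hallH : pi.-Hall(H) 'O_pi(H).
  apply: Hall_pcore_of_der1; first by rewrite (isog_sol HI).
  by rewrite /pgroup (card_isog (isog_der 1 HI)).
have hallA : pi.-Hall(A) 'O_pi(I).
  rewrite /pHall (subset_trans (pcore_sub _ _) (normal_sub nIA)) pcore_pgroup /=.
  rewrite -(Lagrange_index (normal_sub nIA) (pcore_sub pi I)) pnatM piAI /=.
  by have [] := and3P hallI.
have nA : 'O_pi(I) <| A := char_normal_trans (pcore_char pi I) nIA.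
apply/eqP; rewrite eq_sym eqEcard (sub_normal_Hall hallA nA) ?pcore_pgroup ?andbT.
  by rewrite (card_Hall hallI) (card_Hall hallH) (card_isog HI) leqnn.
exact: subset_trans (pcore_sub _ _) sHA.
Qed.

Section Supersolvable.
Variables (gT : finGroupType) (N : {group gT}).

(** The terms are normal in the ambient [N], not merely in [K], so that a series can be prolonged
    until it reaches [N], where the notion becomes [supersolvable N]. *)
Definition cyclic_series (K : {group gT}) :=
  exists s : seq {group gT},
    [/\ path (fun H K : {group gT} => (H \subset K) && cyclic (K / H)) 1%G s,
        last 1%G s = K
      & all (fun H : {group gT} => H <| N) s].

(** The elements of [ys], which generate [L] modulo [K], are adjoined one at a time. Since every
    conjugate of [y] is a power of [y] modulo [K], each step gives a normal subgroup with cyclic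
    factor. *)
Lemma cyclic_series_ext (K L : {group gT}) (ys : seq gT) :
    cyclic_series K -> K <| N -> L \subset N -> {subset ys <= L} -> K \subset L ->
    (forall M : {group gT}, K \subset M -> {subset ys <= M} -> L \subset M) ->
    (forall y n, y \in ys -> n \in N -> exists k, (y ^+ k)^-1 * y ^ n \in K) ->
  cyclic_series L.
Proof.
elim: ys K => [|y ys IH] K rK nKN sLN ysL sKL genL Hy.
  suff <- : K = L by [].
  by apply/group_inj/eqP; rewrite eqEsubset sKL genL.
have Ly : y \in L by apply: ysL; rewrite mem_head.
have Ny : y \in N := subsetP sLN _ Ly.
pose K1 := (K <*> <[y]>)%G.
have sKK1 : K \subset K1 := joing_subl _ _.
have K1y : y \in K1 by rewrite (subsetP (joing_subr _ _)) ?cycle_id.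
have nK1 : K1 <| N.
  rewrite /normal join_subG (normal_sub nKN) cycle_subG Ny /=.
  apply/subsetP=> n Nn; rewrite inE conjYg join_subG; apply/andP; split.
    by rewrite (normP (subsetP (normal_norm nKN) n Nn)).
  rewrite -cycleJ cycle_subG; have [k hk] := Hy y n (mem_head _ _) Nn.
  by rewrite -(mulKVg (y ^+ k) (y ^ n)) groupM ?groupX // (subsetP sKK1).
apply: (IH K1) => //.
- case: rK => s [ps ls alls]; exists (rcons s K1); split.
  + rewrite rcons_path ps ls sKK1 /= quotientYidl ?quotient_cycle ?cycle_cyclic //.
      by rewrite (subsetP (normal_norm nKN)).
    by rewrite cycle_subG (subsetP (normal_norm nKN)).
  + by rewrite last_rcons.
  by rewrite all_rcons nK1.
- by move=> z zs; apply: ysL; rewrite inE zs orbT.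
- by rewrite join_subG sKL cycle_subG.
- move=> M sK1M ysM; apply: genL; first exact: subset_trans sKK1 sK1M.
  by move=> z; rewrite inE => /predU1P[->|/ysM //]; apply: (subsetP sK1M).
move=> z n zs Nn; have [|k hk] := Hy z n _ Nn; first by rewrite inE zs orbT.
by exists k; apply: (subsetP sKK1).
Qed.

Lemma cyclic_series1 : cyclic_series 1%G. Proof. by exists [::]. Qed.
End Supersolvable.

(** * The group of a graph *)

(* A semidirect product of a nilpotent quotient of a right-angled Artin group:
   [(a, b, t)] stands for the product of [b], in the span of the commutators
   [x_u, x_v], of the element of [U] with coordinates [a] on the [x_v], and of
   the torus element [t].  The function [b] is only required to be
   antisymmetric and supported on edges in the subgroup [raag_torus] below. *)
Definition raag (F : finFieldType) (V : finType) (e : rel V) : Type :=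
  ({ffun V -> F} * {ffun V * V -> F} * {ffun V -> {unit F}})%type.

Definition uv (F : finFieldType) (x : {unit F}) : F := val x.
Lemma uvM (F : finFieldType) (x y : {unit F}) : uv (x * y) = (uv x * uv y)%R.
Proof. by []. Qed.
Lemma uv1 (F : finFieldType) : uv (1 : {unit F}) = 1%R.
Proof. by []. Qed.
Lemma uv_inj (F : finFieldType) : injective (@uv F).
Proof. exact: val_inj. Qed.
Lemma uv_neq0 (F : finFieldType) (x : {unit F}) : (uv x != 0)%R.
Proof. by rewrite -unitfE; exact: (valP x). Qed.

Definition ind (F : finFieldType) (b : bool) : F := b%:R%R.

Section RaagType.
Variables (F : finFieldType) (V : finType) (e : rel V).
Local Notation gT := (raag F e).
HB.instance Definition _ := Finite.on gT.

Definition ei (u v : V) : F := ind F (e u v).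

Definition mk (a : V -> F) (b : V -> V -> F) (t : V -> {unit F}) : gT :=
  ([ffun v => a v], [ffun q => b q.1 q.2], [ffun v => t v]).

Definition pv (n : gT) (v : V) : F := n.1.1 v.
Definition pe (n : gT) (u v : V) : F := n.1.2 (u, v).
Definition pt (n : gT) (v : V) : {unit F} := n.2 v.

Lemma pv_mk a b t v : pv (mk a b t) v = a v.
Proof. by rewrite /pv ffunE. Qed.
Lemma pe_mk a b t u v : pe (mk a b t) u v = b u v.
Proof. by rewrite /pe ffunE. Qed.
Lemma pt_mk a b t v : pt (mk a b t) v = t v.
Proof. by rewrite /pt ffunE. Qed.

Lemma raagP (m n : gT) :
  pv m =1 pv n -> pe m =2 pe n -> pt m =1 pt n -> m = n.
Proof.
case: m n => [[a b] t] [[a' b'] t']; rewrite /pv /pe /pt /= => ea eb et.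
congr (_, _, _); apply/ffunP => // -[u v]; exact: eb.
Qed.

Let one : gT := mk (fun=> 0%R) (fun _ _ => 0%R) (fun=> 1).
(** The torus acts with weight [t v] on the vertex [v] and [t u * t v] on the pair [(u, v)]; the
    last term of the second component is an alternating cocycle. It vanishes on proportional
    vectors, so powers in [U] are coordinatewise, and commutators in [U] are twice the cocycle. *)
Let mul (m n : gT) : gT := mk
  (fun v => pv m v + uv (pt m v) * pv n v)%R
  (fun u v => pe m u v + uv (pt m u) * uv (pt m v) * pe n u v
     + ei u v * (pv m u * (uv (pt m v) * pv n v) - pv m v * (uv (pt m u) * pv n u)))%R
  (fun v => pt m v * pt n v).
Let inv (m : gT) : gT := mk
  (fun v => - (uv (pt m v)^-1%g * pv m v))%R
  (fun u v => - (uv (pt m u)^-1%g * uv (pt m v)^-1%g * pe m u v))%R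
  (fun v => (pt m v)^-1).

Fact raag_mulA : associative mul.
Proof.
by move=> x y z; apply: raagP => [v|u v|v];
  rewrite ?(pv_mk, pe_mk, pt_mk, uvM, mulgA) //; ring.
Qed.
Fact raag_mul1 : left_id one mul.
Proof.
by move=> x; apply: raagP => [v|u v|v];
  rewrite ?(pv_mk, pe_mk, pt_mk, uv1, mul1g) //; ring.
Qed.
Fact raag_mulV : left_inverse one inv mul.
Proof.
by move=> x; apply: raagP => [v|u v|v];
  rewrite ?(pv_mk, pe_mk, pt_mk, mulVg) //; ring.
Qed.

HB.instance Definition _ := Finite_isGroup.Build gT raag_mulA raag_mul1 raag_mulV.

Lemma pv1 v : pv (1 : gT) v = 0%R. Proof. exact: pv_mk. Qed.
Lemma pe1 u v : pe (1 : gT) u v = 0%R. Proof. exact: pe_mk. Qed.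
Lemma pt1 v : pt (1 : gT) v = 1. Proof. exact: pt_mk. Qed.
Lemma pvM (m n : gT) v : pv (m * n) v = (pv m v + uv (pt m v) * pv n v)%R.
Proof. exact: pv_mk. Qed.
Lemma peM (m n : gT) u v : pe (m * n) u v =
  (pe m u v + uv (pt m u) * uv (pt m v) * pe n u v
     + ei u v * (pv m u * (uv (pt m v) * pv n v) - pv m v * (uv (pt m u) * pv n u)))%R.
Proof. exact: pe_mk. Qed.
Lemma ptM (m n : gT) v : pt (m * n) v = pt m v * pt n v.
Proof. exact: pt_mk. Qed.
Lemma ptX (n : gT) k v : pt (n ^+ k) v = pt n v ^+ k.
Proof. by elim: k => [|k IH]; rewrite ?expg0 ?pt1 // !expgS ptM IH. Qed.
Lemma pvV (m : gT) v : pv m^-1 v = (- (uv (pt m v)^-1%g * pv m v))%R.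
Proof. exact: pv_mk. Qed.
Lemma peV (m : gT) u v : pe m^-1 u v = (- (uv (pt m u)^-1%g * uv (pt m v)^-1%g * pe m u v))%R.
Proof. exact: pe_mk. Qed.
Lemma ptV (m : gT) v : pt m^-1 v = (pt m v)^-1.
Proof. exact: pt_mk. Qed.
End RaagType.

Local Notation raagE := (pvM, peM, ptM, pvV, peV, ptV, pv1, pe1, pt1, pv_mk, pe_mk, pt_mk,
  uvM, uv1, invg1, mul1g, mulg1).

(** * The torus extension, its subgroups and its generators *)

Section RaagTorus.
Variables (p : nat) (F : finFieldType) (V : finType) (e : rel V).
Hypotheses (p_pr : prime p) (p_gt2 : 2 < p) (pcharF : p \in [pchar F]%R)
  (F_nat : forall c : F, exists k : nat, c = k%:R%R)
  (e_sym : symmetric e) (e_irr : irreflexive e).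

Local Notation gT := (raag F e).

Lemma two_neq0 : (2%:R != 0 :> F)%R.
Proof.
rewrite -(dvdn_pcharf pcharF); apply/negP=> /dvdn_leq; lia.
Qed.

Lemma unitF_comm (x y : {unit F}) : x * y = y * x.
Proof. by apply: uv_inj; rewrite !uvM mulrC. Qed.

Lemma ind1 : ind F true = 1%R. Proof. by []. Qed.
Lemma ind0 : ind F false = 0%R. Proof. by []. Qed.

Lemma ei_sym u v : ei F e u v = ei F e v u.
Proof. by rewrite /ei e_sym. Qed.

(** Keeping both orientations of an edge, tied by antisymmetry, avoids a choice of order on the
    vertices. *)
Definition edge_supp (n : gT) :=
  [forall u, forall v, (pe n u v == - pe n v u)%R && (e u v || (pe n u v == 0)%R)].

Lemma edge_suppP n :
  reflect (forall u v, pe n u v = (- pe n v u)%R /\ (e u v = false -> pe n u v = 0%R)) (edge_supp n).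
Proof.
apply: (iffP forallP) => [H u v|H u].
  have /forallP/(_ v)/andP[/eqP-> /orP h] := H u; split=> // euv.
  by case: h => [|/eqP <- //]; rewrite ?euv // => /eqP.
apply/forallP=> v; have [-> h] := H u v; rewrite eqxx /=.
by case: (e u v) h => //= h; rewrite h.
Qed.

Definition raag_torus_set := [set n | edge_supp n].
Fact raag_torus_group_set : group_set raag_torus_set.
Proof.
apply/group_setP; split=> [|m n].
  by rewrite inE; apply/edge_suppP=> u v; rewrite !raagE oppr0.
rewrite !inE => /edge_suppP Hm /edge_suppP Hn; apply/edge_suppP=> u v.
rewrite !raagE; split.
  by rewrite (Hm u v).1 (Hn u v).1 (ei_sym v u); ring.
by move=> euv; rewrite ((Hm u v).2 euv) ((Hn u v).2 euv) /ei euv ind0 mulr0 mul0r !addr0.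
Qed.
Canonical raag_torus := Group raag_torus_group_set.
Local Notation N := raag_torus.

Lemma in_raag_torus n : reflect
  (forall u v, pe n u v = (- pe n v u)%R /\ (e u v = false -> pe n u v = 0%R)) (n \in N).
Proof. rewrite inE; exact: edge_suppP. Qed.

Definition unip_set := [set n in N | [forall v, pt n v == 1]].
Lemma in_unip_set n : (n \in unip_set) = (n \in N) && [forall v, pt n v == 1].
Proof. by rewrite inE. Qed.
Fact unip_group_set : group_set unip_set.
Proof.
apply/group_setP; split=> [|m n].
  by rewrite in_unip_set group1; apply/forallP=> v; rewrite !raagE.
rewrite !in_unip_set => /andP[Nm /forallP Hm] /andP[Nn /forallP Hn].
rewrite groupM //=; apply/forallP=> v; by rewrite !raagE (eqP (Hm v)) (eqP (Hn v)) mul1g.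
Qed.
Canonical unip := Group unip_group_set.
Local Notation U := unip.

Lemma in_unip n : reflect (n \in N /\ forall v, pt n v = 1) (n \in U).
Proof.
rewrite in_unip_set; apply: (iffP andP) => -[Nn H]; split=> //.
  by move=> v; exact/eqP/(forallP H).
by apply/forallP=> v; rewrite H.
Qed.

(** This is the derived subgroup of [U], as [unip_der1] shows. *)
Definition edgesub_set := [set n in U | [forall v, pv n v == 0%R]].
Lemma in_edgesub_set n : (n \in edgesub_set) = (n \in U) && [forall v, pv n v == 0%R].
Proof. by rewrite inE. Qed.
Fact edgesub_group_set : group_set edgesub_set.
Proof.
apply/group_setP; split=> [|m n].
  by rewrite in_edgesub_set group1; apply/forallP=> v; rewrite !raagE.
rewrite !in_edgesub_set => /andP[Nm /forallP Hm] /andP[Nn /forallP Hn].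
rewrite groupM //=; apply/forallP=> v.
by rewrite !raagE (eqP (Hm v)) (eqP (Hn v)) mulr0 addr0.
Qed.
Canonical edgesub := Group edgesub_group_set.
Local Notation Z := edgesub.

Lemma in_edgesub n : reflect [/\ n \in N, forall v, pt n v = 1 & forall v, pv n v = 0%R] (n \in Z).
Proof.
rewrite in_edgesub_set; apply: (iffP andP) => [[/in_unip[Nn H1] H]|[Nn H1 H]]; split=> //.
- by move=> v; exact/eqP/(forallP H).
- exact/in_unip.
by apply/forallP=> v; rewrite H.
Qed.

Definition torus_set := [set n : gT | [forall v, pv n v == 0%R] & [forall u, forall v, pe n u v == 0%R]].
Lemma in_torus_set n : reflect ((forall v, pv n v = 0%R) /\ (forall u v, pe n u v = 0%R)) (n \in torus_set).
Proof.
rewrite inE; apply: (iffP andP) => -[H1 H2]; split.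
- by move=> v; exact/eqP/(forallP H1).
- by move=> u v; exact/eqP/(forallP (forallP H2 u)).
- by apply/forallP=> v; rewrite H1.
by apply/forallP=> u; apply/forallP=> v; rewrite H2.
Qed.
Fact torus_group_set : group_set torus_set.
Proof.
apply/group_setP; split=> [|m n].
  by apply/in_torus_set; split=> *; rewrite raagE.
move=> /in_torus_set[H1 H2] /in_torus_set[H3 H4].
by apply/in_torus_set; split=> *; rewrite !raagE ?(H1, H2, H3, H4); ring.
Qed.
Canonical torus := Group torus_group_set.
Local Notation T := torus.
Lemma in_torus n : reflect ((forall v, pv n v = 0%R) /\ (forall u v, pe n u v = 0%R)) (n \in T).
Proof. exact: in_torus_set. Qed.

Lemma torus_sub : T \subset N.
Proof.
apply/subsetP=> n /in_torus[_ H]; apply/in_raag_torus=> u v.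
by rewrite !H oppr0.
Qed.
Lemma unip_sub : U \subset N.
Proof. by apply/subsetP=> n /in_unip[]. Qed.
Lemma edgesub_sub : Z \subset U.
Proof. by apply/subsetP=> n /in_edgesub[Nn H _]; apply/in_unip. Qed.

Lemma unip_normal : U <| N.
Proof.
rewrite /normal unip_sub; apply/subsetP=> n Nn; rewrite inE.
apply/subsetP=> _ /imsetP[m /in_unip[Nm H] ->]; apply/in_unip; split.
  by rewrite groupJ.
by move=> v; rewrite !raagE H mul1g mulVg.
Qed.
Lemma edgesub_normal : Z <| N.
Proof.
rewrite /normal (subset_trans edgesub_sub unip_sub); apply/subsetP=> n Nn; rewrite inE.
apply/subsetP=> _ /imsetP[m /in_edgesub[Nm H H0] ->]; apply/in_edgesub; split.
- by rewrite groupJ.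
- by move=> v; rewrite !raagE H mul1g mulVg.
by move=> v; rewrite !raagE H H0 ?raagE; ring.
Qed.

Lemma der1_sub_unip : N^`(1) \subset U.
Proof.
rewrite gen_subG; apply/subsetP=> _ /imset2P[x y Nx Ny ->].
apply/in_unip; split; first by rewrite groupR.
by move=> v; rewrite !raagE (unitF_comm (pt x v)) mulKg mulVg.
Qed.

Lemma pvX y k v : y \in U -> pv (y ^+ k) v = (k%:R * pv y v)%R.
Proof.
move=> /in_unip[_ Hy]; elim: k => [|k IH]; first by rewrite expg0 pv1 mul0r.
by rewrite expgS !raagE IH Hy uv1 -natr1; ring.
Qed.
Lemma peX y k u v : y \in U -> pe (y ^+ k) u v = (k%:R * pe y u v)%R.
Proof.
move=> Uy; have /in_unip[_ Hy] := Uy.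
elim: k => [|k IH]; first by rewrite expg0 pe1 mul0r.
by rewrite expgS !raagE IH !pvX // !Hy uv1 -natr1; ring.
Qed.

Lemma unip_pgroup : p.-group U.
Proof.
rewrite -pnat_exponent; have d: exponent U %| p.
  apply/exponentP=> y Uy; apply: raagP => [v|u v|v]; rewrite ?raagE ?pvX ?peX //.
  - by rewrite (pcharf0 pcharF) mul0r.
  - by rewrite (pcharf0 pcharF) mul0r.
  by have /in_unip[_ ->] := groupX p Uy.
exact: pnat_dvd d (pnat_id p_pr).
Qed.

Definition toremb (t : V -> {unit F}) : gT := mk e (fun=> 0%R) (fun _ _ => 0%R) t.
Definition vgen v (c : F) : gT := mk e (fun w => c * ind F (w == v))%R (fun _ _ => 0%R) (fun=> 1).
Definition egen u v (c : F) : gT :=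
  mk e (fun=> 0%R) (fun i j => c * (ind F ((i, j) == (u, v)) - ind F ((j, i) == (u, v))))%R (fun=> 1).

Lemma toremb_in t : toremb t \in T.
Proof. by apply/in_torus; split=> *; rewrite raagE. Qed.
Lemma vgen_in v c : vgen v c \in U.
Proof.
apply/in_unip; split=> *; last by rewrite raagE.
by apply/in_raag_torus=> *; rewrite !raagE oppr0.
Qed.
Lemma egen_in u v c : e u v -> egen u v c \in Z.
Proof.
move=> euv; apply/in_edgesub; split=> *; rewrite ?raagE //.
apply/in_raag_torus=> i j; rewrite !raagE; split; first by ring.
move=> eij; case: eqP => [[? ?]|_]; first by subst; rewrite euv in eij.
case: eqP => [[? ?]|_]; first by subst; rewrite e_sym euv in eij.
by rewrite subrr mulr0.
Qed.

Lemma edgesub_gen (W : {group gT}) :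
  (forall u v c, e u v -> egen u v c \in W) -> Z \subset W.
Proof.
move=> HW; apply/subsetP=> n /in_edgesub[/in_raag_torus Hn Hpt Hpv].
(* Each edge occurs as two ordered pairs, which contribute the same element, so each takes half of
   the coordinate. *)
pose c (q : V * V) : F := (pe n q.1 q.2 / 2%:R)%R.
have Wc q : egen q.1 q.2 (c q) \in W.
  case euv: (e q.1 q.2); first exact: HW.
  suff ->: egen q.1 q.2 (c q) = 1 by apply: group1.
  by apply: raagP => [w|i j|w]; rewrite !raagE // /c (Hn _ _).2 // mul0r mul0r.
pose f (r : seq (V * V)) i j : F := (\sum_(q <- r) c q * (ind F ((i, j) == q) - ind F ((j, i) == q)))%R.
have Wr r : mk e (fun=> 0%R) (f r) (fun=> 1) \in W.
  elim: r => [|q r IH].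
    suff ->: mk e (fun=> 0%R) (f [::]) (fun=> 1) = 1 by apply: group1.
    by apply: raagP => [w|i j|w]; rewrite !raagE // /f big_nil.
  suff ->: mk e (fun=> 0%R) (f (q :: r)) (fun=> 1) = egen q.1 q.2 (c q) * mk e (fun=> 0%R) (f r) (fun=> 1).
    by rewrite groupM.
  apply: raagP => [w|i j|w]; rewrite !raagE ?mulr0 ?addr0 //.
  by rewrite /f big_cons -surjective_pairing; ring.
suff ->: n = mk e (fun=> 0%R) (f (index_enum _)) (fun=> 1) by [].
apply: raagP => [v|u v|v]; rewrite ?raagE //.
have pick i j : (\sum_q c q * ind F ((i, j) == q) = c (i, j))%R.
  rewrite (bigD1 (i, j)) //= eqxx ind1 mulr1 big1 ?addr0 // => q; rewrite eq_sym => /negbTE->.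
  by rewrite ind0 mulr0.
rewrite /f (eq_bigr (fun q => c q * ind F ((u, v) == q) + - (c q * ind F ((v, u) == q)))%R); last first.
  by move=> q _; rewrite mulrBr.
rewrite big_split /= sumrN !pick /c /= (Hn v u).1.
by field; exact: two_neq0.
Qed.

Lemma unip_gen (W : {group gT}) :
  Z \subset W -> (forall v c, vgen v c \in W) -> U \subset W.
Proof.
move=> ZW HW; apply/subsetP=> n /in_unip[Nn Hpt].
(* Dividing [n] by the product of its vertex components leaves an element of [Z]; the order of the
   factors affects only [Z]. *)
pose y r := \prod_(v <- r) vgen v (pv n v).
have Uy r : y r \in U by apply: group_prod => v _; apply: vgen_in.
have Wy r : y r \in W by apply: group_prod => v _; apply: HW.
have pvy r w : pv (y r) w = (\sum_(v <- r) pv n v * ind F (w == v))%R.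
  rewrite /y; elim: r => [|v r IH]; first by rewrite !big_nil raagE.
  by rewrite !big_cons !raagE IH mul1r.
pose Y := y (index_enum V).
rewrite -(mulgKV Y n) groupM ?Wy //; apply: (subsetP ZW).
have /in_unip[NY HY] : Y \in U by exact: Uy.
have NYn : n * Y^-1 \in N by rewrite groupM ?groupV.
apply/in_edgesub; split=> // v; first by rewrite !raagE Hpt HY invg1 mulg1.
rewrite !raagE Hpt HY pvy (bigD1 v) //= eqxx ind1 big1.
  by rewrite invg1 uv1; ring.
by move=> w; rewrite eq_sym => /negbTE->; rewrite ind0 mulr0.
Qed.

Lemma unip_torusM : U * T = N.
Proof.
apply/eqP; rewrite eqEsubset mul_subG ?unip_sub ?torus_sub //=; apply/subsetP=> n Nn.
have Tt := toremb_in (pt n).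
rewrite -(mulgKV (toremb (pt n)) n) mem_mulg //; apply/in_unip; split.
  by rewrite groupM // groupV (subsetP torus_sub _ Tt).
by move=> v; rewrite !raagE mulgV.
Qed.

Lemma vgenX v c k : vgen v c ^+ k = vgen v (k%:R * c)%R.
Proof.
have Uk := groupX k (vgen_in v c).
apply: raagP => [w|i j|w]; rewrite ?pvX ?peX ?vgen_in // ?raagE ?mulr0 ?mulrA //.
by have /in_unip[_ ->] := Uk.
Qed.

(** The commutator of [vgen u a] and [vgen v b] has coordinate [2ab] at [(u, v)]. *)
Lemma egen_comm u v c : e u v -> egen u v c = [~ vgen u (-1)%R, vgen v (- c / 2%:R)%R].
Proof.
move=> euv.
have uv : u == v = false by apply: contraTF euv => /eqP->; rewrite e_irr.
apply: (mulgI (vgen v (- c / 2%:R)%R * vgen u (-1)%R)); rewrite -commgC.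
apply: raagP => [i|i j|i]; rewrite !raagE ?mul1r ?mulr1 ?mul1g //; first by ring.
rewrite /ei !xpair_eqE !(eq_sym _ u) !(eq_sym _ v).
case iu: (u == i); case jv: (v == j); case ju: (u == j); case iv: (v == i) => /=;
 rewrite ?mulr0 ?mul0r ?mulr1 ?subr0 ?sub0r ?addr0 ?add0r //; try by ring.
all: try by rewrite -(eqP iu) -(eqP jv) /ei euv /=; field; exact: two_neq0.
all: try by rewrite -(eqP iv) -(eqP ju) e_sym euv ind1; field; exact: two_neq0.
all: try by move: iv; rewrite -(eqP iu) (eq_sym v) uv.
all: try by move: jv; rewrite -(eqP ju) (eq_sym v) uv.
Qed.

(** By [F_nat] the field is prime, so every [vgen v c] is a power of [vgen v 1]; commutators of
    these give [Z]. *)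
Lemma raag_torus_gen (W : {group gT}) :
  T \subset W -> (forall v, vgen v 1%R \in W) -> N \subset W.
Proof.
move=> TW HW.
have xW v c : vgen v c \in W.
  have [k ->] := F_nat c.
  by rewrite -[(_%:R)%R]mulr1 -vgenX groupX.
have ZW : Z \subset W.
  by apply: edgesub_gen => u v c euv; rewrite egen_comm // groupR.
rewrite -unip_torusM mul_subG // unip_gen //.
Qed.

End RaagTorus.

(** * Automorphisms *)

Section RaagAut.
Variables (p : nat) (F : finFieldType) (V : finType) (e : rel V).
Hypotheses (p_pr : prime p) (p_gt2 : 2 < p) (pcharF : p \in [pchar F]%R)
  (cardF : #|F| = p) (e_sym : symmetric e) (e_irr : irreflexive e).

Local Notation gT := (raag F e).
Local Notation N := (raag_torus F e_sym).
Local Notation U := (unip F e_sym).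
Local Notation Z := (edgesub F e_sym).
Local Notation T := (torus F e).

Let twoF := two_neq0 p_pr p_gt2 pcharF.
Fact two_unit : (2%:R : F)%R \is a GRing.unit.
Proof. by rewrite unitfE twoF. Qed.
Definition two_u : {unit F} := FinRing.unit F two_unit.
Lemma two_neq1 : (2%:R == 1 :> F)%R = false.
Proof. by rewrite -subr_eq0 (_ : 2%:R - 1 = 1)%R ?oner_eq0 //; ring. Qed.
(** A test element whose action has the nontrivial scalar 2 at the single vertex [v]. It separates
    the weights, and for the chosen [p] its order divides [l]. *)
Definition tdelta v : gT := toremb e (fun w => if w == v then two_u else 1).
Lemma tdelta_in v : tdelta v \in T. Proof. exact: toremb_in. Qed.
Lemma uv_tdelta v w : uv (pt (tdelta v) w) = if w == v then 2%:R%R else 1%R.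
Proof. by rewrite raagE; case: ifP. Qed.

Lemma torus_pgroup : p^'.-group T.
Proof.
rewrite -pnat_exponent.
have d : exponent T %| p.-1.
  apply/exponentP=> t Tt; have /in_torus[Ht1 Ht2] := groupX p.-1 Tt.
  apply: raagP => [w|u w|w]; rewrite ?raagE //.
  rewrite ptX.
  by rewrite -cardF -card_finField_unit expg_cardG ?inE.
apply: pnat_dvd d _; rewrite p'natE //; apply/negP=> /dvdn_leq; lia.
Qed.

Lemma unip_Hall : p.-Hall(N) U.
Proof.
rewrite /pHall unip_sub unip_pgroup //= -card_quotient ?normal_norm ?unip_normal //.
rewrite -(unip_torusM F e_sym) quotientMidl.
exact: quotient_pgroup torus_pgroup.
Qed.

Lemma pcore_raag : 'O_p(N) = U.
Proof. exact: normal_Hall_pcore unip_Hall (unip_normal _ _). Qed.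

(** Commuting with [tdelta v] kills the coordinate at [v] and those of the edges at [v]; commuting
    with the generator at [v] then makes the torus part trivial at [v]. *)
Lemma center_raag : 'Z(N) = 1.
Proof.
apply/trivgP/subsetP=> n /centerP[Nn Cn]; apply/set1P.
have CT v : n * tdelta v = tdelta v * n.
  by apply: Cn; apply: (subsetP (torus_sub F e_sym)); apply: tdelta_in.
have Cv v : n * vgen e v 1%R = vgen e v 1%R * n.
  by apply: Cn; apply: (subsetP (unip_sub F e_sym)); apply: vgen_in.
have n0 v : pv n v = 0%R.
  have /(congr1 (fun m => pv m v)) := CT v; rewrite !pvM uv_tdelta eqxx.
  have /in_torus[-> _] := tdelta_in v; rewrite mulr0 addr0 add0r => h.
  by apply: (addrI (pv n v)); rewrite addr0 {3}h; ring.
have /in_raag_torus Hn := Nn.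
apply: raagP => [v|u v|v]; rewrite raagE //.
  have [<-|uv] := eqVneq u v; first by rewrite (Hn u u).2 // e_irr.
  have /(congr1 (fun m => pe m u v)) := CT u; rewrite !peM !uv_tdelta eqxx eq_sym (negbTE uv).
  have /in_torus[h1 h2] := tdelta_in u; rewrite !h1 !h2 !n0.
  rewrite !(mulr0, mulr1, mul1r, mul0r, subr0, oppr0, addr0, add0r) => h.
  by apply: (addrI (pe n u v)); rewrite addr0 {3}h; ring.
have /(congr1 (fun m => pv m v)) := Cv v.
rewrite !raagE n0 /ind eqxx mulr0 addr0 add0r !mulr1 => h.
by apply: uv_inj; rewrite h.
Qed.

Lemma unip_der1 : U^`(1) = Z.
Proof.
apply/eqP; rewrite eqEsubset; apply/andP; split.
  rewrite gen_subG; apply/subsetP=> _ /imset2P[x y Ux Uy ->].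
  have /in_unip[NR RR] := groupR Ux Uy.
  apply/in_edgesub; split=> // v.
  have /in_unip[_ hx] := Ux; have /in_unip[_ hy] := Uy.
  by rewrite !raagE !hx !hy ?raagE; ring.
apply: (@edgesub_gen p F V e p_pr p_gt2 pcharF e_sym U^`(1)%G) => u v c euv.
by rewrite (egen_comm p_pr p_gt2 pcharF e_sym e_irr c euv) mem_commg ?vgen_in.
Qed.

Lemma edgesub_char : Z \char N.
Proof. by rewrite -unip_der1 -pcore_raag (char_trans (der_char _ _)) ?pcore_char. Qed.

Lemma torus_vgen r v c : r \in T -> r * vgen e v c = vgen e v (uv (pt r v) * c)%R * r.
Proof.
move=> /in_torus[h1 h2]; apply: raagP => [w|u w|w]; rewrite !raagE ?h1 ?h2 ?raagE //.
  case: eqVneq => [->|_]; first by ring.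
  by rewrite /ind !mulr0 !addr0.
by ring.
Qed.

(** The inverse makes the generator at [v] go to the one at [s v]. *)
Definition relabel (s : {perm V}) (n : gT) : gT :=
  mk e (fun v => pv n (s^-1 v)) (fun u v => pe n (s^-1 u) (s^-1 v)) (fun v => pt n (s^-1 v)).

Lemma relabelK s : cancel (relabel s) (relabel s^-1).
Proof. by move=> n; apply: raagP => [v|u v|v]; rewrite !raagE invgK !permK. Qed.
Definition relabel_perm s : {perm gT} := perm (can_inj (relabelK s)).
(** Elements of [Aut N] are permutations of the whole type that fix everything outside [N], hence
    the restriction. *)
Definition relabel_aut s : {perm gT} := restr_perm N (relabel_perm s).

Definition graph_aut (s : {perm V}) := forall u v, e (s u) (s v) = e u v.

Lemma graph_autV s : graph_aut s -> graph_aut s^-1.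
Proof. by move=> h u v; rewrite -[in RHS](permKV s u) -[in RHS](permKV s v) h. Qed.

Lemma relabel_in s n : graph_aut s -> n \in N -> relabel s n \in N.
Proof.
move=> /graph_autV h /in_raag_torus Hn; apply/in_raag_torus=> u v; rewrite !raagE.
split; first exact: (Hn _ _).1.
by rewrite -(h u v); apply: (Hn _ _).2.
Qed.

Lemma relabelM s : graph_aut s -> {morph relabel s : m n / m * n}.
Proof.
move=> /graph_autV h m n; apply: raagP => [v|u v|v]; rewrite !raagE //.
by rewrite /ei h.
Qed.

Lemma relabel_autE s n : graph_aut s -> n \in N -> relabel_aut s n = relabel s n.
Proof.
move=> h Nn; rewrite restr_permE // ?permE //.
rewrite inE /= !inE /=; apply/subsetP=> x Nx; rewrite inE /aperm permE.
exact: relabel_in.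
Qed.

Lemma relabel_aut_in s : graph_aut s -> relabel_aut s \in Aut N.
Proof.
move=> h; rewrite inE restr_perm_on; apply/morphicP=> x y Nx Ny.
by rewrite !relabel_autE ?groupM // relabelM.
Qed.

Lemma relabel_autM s t : graph_aut s -> graph_aut t ->
  relabel_aut (s * t) = relabel_aut s * relabel_aut t.
Proof.
move=> hs ht; have hst : graph_aut (s * t) by move=> u v; rewrite !permM ht hs.
apply: (@eq_Aut _ N); rewrite ?groupM ?relabel_aut_in // => n Nn.
rewrite permM !relabel_autE ?relabel_in //.
by apply: raagP => [v|u v|v]; rewrite !raagE invMg !permM.
Qed.

Lemma relabel_vgen s v c : relabel s (vgen e v c) = vgen e (s v) c.
Proof.
apply: raagP => [w|u w|w]; rewrite !raagE //.
by rewrite -(inj_eq (@perm_inj _ s)) permKV.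
Qed.

(** On an edge the two products have coordinates 1 and -1, distinct as [p] is odd. Thus commutation
    recovers the graph, and an automorphism permuting the generators permutes the vertices as a
    graph automorphism. *)
Lemma vgen_comm u v : commute (vgen e u (1%R : F)) (vgen e v (1%R : F)) <-> ~~ e u v.
Proof.
have [<-|uv] := eqVneq u v; first by rewrite e_irr; split.
have vu : (v == u) = false by rewrite eq_sym (negbTE uv).
split=> [/(congr1 (fun m => pe m u v))|euv].
  rewrite !raagE /ei; case: (e u v) => //=; rewrite /ind !eqxx (negbTE uv) vu /=.
  rewrite !(mulr0, mulr1, mul1r, mul0r, subr0, addr0, add0r, sub0r) => h.
  by move: twoF; rewrite mulr2n {1}h addNr eqxx.
apply: raagP => [w|i j|w]; rewrite !raagE //; first by ring.
rewrite /ei; case eij: (e i j); last by rewrite /ind !mul0r.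
have [iu|iu] := eqVneq i u; have [jv|jv] := eqVneq j v.
- by rewrite -iu -jv eij in euv.
- by rewrite iu (negbTE uv) /= /ind !mulr0 !mul0r !subr0 ?mulr0.
- have [ju|ju] := eqVneq j u; first by rewrite jv in ju; rewrite ju eqxx in uv.
  have [iv|iv] := eqVneq i v; last by rewrite /ind !(mulr0, mul0r, subr0).
  by rewrite iv jv e_irr in eij.
have [ju|ju] := eqVneq j u; have [iv|iv] := eqVneq i v.
- by rewrite ju iv e_sym in eij; rewrite eij in euv.
all: by rewrite /ind !(mulr0, mul0r, subr0).
Qed.
End RaagAut.

Lemma conj_aut_Aut (gT : finGroupType) (G : {group gT}) x : conj_aut G x \in Aut G.
Proof. exact: Aut_aut. Qed.

Section RaagAut2.
Variables (p : nat) (F : finFieldType) (V : finType) (e : rel V).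
Hypotheses (p_pr : prime p) (p_gt2 : 2 < p) (pcharF : p \in [pchar F]%R)
  (F_nat : forall c : F, exists k : nat, c = k%:R%R)
  (cardF : #|F| = p) (e_sym : symmetric e) (e_irr : irreflexive e).

Local Notation gT := (raag F e).
Local Notation N := (raag_torus F e_sym).
Local Notation U := (unip F e_sym).
Local Notation Z := (edgesub F e_sym).
Local Notation T := (torus F e).
Local Notation x_ v := (vgen e v (1%R : F)).

(** The image of [T] and [T] itself are complements of the solvable normal Hall subgroup [U], so
    they are conjugate by an element of [U]. *)
Lemma aut_torus (phi : {perm gT}) : phi \in Aut N ->
  exists2 x, x \in N & forall t, t \in T -> (phi * conj_aut N x) t \in T.
Proof.
move=> Aphi; pose f := autm_morphism Aphi.
have fN : f @* N = N by exact: im_autm.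
have injf : 'injm f by exact: injm_autm.
have TN := torus_sub F e_sym; have UN := unip_sub F e_sym.
have UT := unip_torusM F e_sym.
have solU : solvable U by apply: pgroup_sol; exact: (unip_pgroup p_pr pcharF).
have nUT : T \subset 'N(U) := subset_trans TN (normal_norm (unip_normal F e_sym)).
have sTU : f @* T \subset U * T by have := morphimS f TN; rewrite fN UT.
have co : coprime #|U| #|T|.
  apply: (pnat_coprime (unip_pgroup p_pr pcharF e_sym)).
  exact: (torus_pgroup e p_pr p_gt2 pcharF cardF).
have [x Ux eT] := SchurZassenhaus_trans_sol solU nUT sTU co (card_injm injf TN).
have Nx : x \in N := subsetP UN _ Ux.
exists x^-1; first by rewrite groupV.
move=> t Tt; have Nt := subsetP TN _ Tt.
have : f t \in T :^ x.
  by rewrite -eT /=; apply: mem_morphim.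
rewrite mem_conjg /= autmE => h.
by rewrite permM conj_autE ?groupV ?Aut_closed.
Qed.

Section TorusPreserving.
Variables (phi : {perm gT}) (Aphi : phi \in Aut N) (phiT : forall t, t \in T -> phi t \in T).

Let phiM : {in N &, {morph phi : x y / x * y}}.
Proof. exact/morphicP/(Aut_morphic Aphi). Qed.
Let TN n : n \in T -> n \in N. Proof. exact: (subsetP (torus_sub F e_sym)). Qed.
Let UN n : n \in U -> n \in N. Proof. exact: (subsetP (unip_sub F e_sym)). Qed.
Let xN v c : vgen e v c \in N. Proof. exact/UN/vgen_in. Qed.

Let phi_char (A : {group gT}) x : A \char N -> x \in N -> (phi x \in A) = (x \in A).
Proof.
move=> /charP[AN /(_ (autm_morphism Aphi) (injm_autm Aphi) (im_autm Aphi)) fA] Nx.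
rewrite -{1}fA /= morphimEsub //.
by rewrite /= autmE mem_imset //; apply: perm_inj.
Qed.

Let phiU x : x \in N -> (phi x \in U) = (x \in U).
Proof.
apply: phi_char; rewrite -(pcore_raag p_pr p_gt2 pcharF cardF e_sym); exact: pcore_char.
Qed.

Let phiZ x : x \in N -> (phi x \in Z) = (x \in Z).
Proof. by apply: phi_char; exact: (edgesub_char p_pr p_gt2 pcharF cardF e_sym e_irr). Qed.

Let phiX x k : x \in N -> phi (x ^+ k) = phi x ^+ k.
Proof.
move=> Nx; elim: k => [|k IH]; last by rewrite !expgS phiM ?groupX // IH.
have h : phi 1 * phi 1 = phi 1 * 1 by rewrite -phiM // !mulg1.
by rewrite !expg0; apply: (mulgI (phi 1)); exact: h.
Qed.

Let phiT_surj s : s \in T -> exists2 r, r \in T & phi r = s.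
Proof.
move=> Ts; have : s \in phi @: T.
  suff /eqP-> : phi @: T == T by [].
  rewrite eqEcard card_imset ?leqnn ?andbT; last exact: perm_inj.
  by apply/subsetP=> _ /imsetP[t Tt ->]; apply: phiT.
by case/imsetP=> r Tr ->; exists r.
Qed.

(* A vector of [U] on which [T] acts by scalars lies on a weight line; as it is
   not in [Z], the line is that of a vertex. *)
Lemma aut_vertex v : exists w c, (c != 0)%R /\ phi (x_ v) = vgen e w c.
Proof.
set y := phi (x_ v).
have Uy : y \in U by rewrite phiU ?vgen_in.
have nZy : y \notin Z.
  rewrite phiZ //; apply/negP=> /in_edgesub[_ _ /(_ v)]; rewrite raagE /ind eqxx mulr1.
  by move/eqP; rewrite oner_eq0.
have /in_unip[Ny pty] := Uy; have /in_raag_torus Hy := Ny.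
(* With [s] the image of [r], the relation between [r] and [x_ v] is carried over by [phi]; writing
   the scalar as a natural number turns it into an exponent, which [phi] respects. *)
have scal s : s \in T -> exists k : F,
    (forall w, uv (pt s w) * pv y w = k * pv y w)%R /\
    (forall u w, uv (pt s u) * uv (pt s w) * pe y u w = k * pe y u w)%R.
  move=> Ts; have [r Tr rs] := phiT_surj Ts; have [k kr] := F_nat (uv (pt r v)).
  have h : s * y = y ^+ k * s.
    rewrite -rs /y -phiX // -!phiM ?(TN Tr) ?groupX // (vgenX e_sym).
    by congr (phi _); rewrite torus_vgen // kr.
  exists k%:R%R; have /in_torus[s1 s2] := Ts; split=> [w|u w].
    have /(congr1 (fun m => pv m w)) := h; rewrite !pvM (pvX _ _ Uy) !s1 mulr0 add0r addr0.
    by [].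
  have /(congr1 (fun m => pe m u w)) := h.
  by rewrite !peM (peX _ _ _ Uy) !s1 !s2 !(mulr0, mul0r, add0r, addr0, subr0, oppr0).
have [w yw] : exists w, (pv y w != 0)%R.
  apply/existsP; apply: contraR nZy; rewrite negb_exists => /forallP h.
  by apply/in_edgesub; split=> // w; apply/eqP; have := h w; rewrite negbK.
have kE (s : gT) (k : F) : (uv (pt s w) * pv y w = k * pv y w)%R -> k = uv (pt s w).
  by move/(mulIf yw).
have two1 := two_neq1 F.
pose td := tdelta e p_pr p_gt2 pcharF.
have Ttd z : td z \in T by exact: tdelta_in.
have tdE z z' : uv (pt (td z) z') = (if z' == z then 2%:R else 1)%R by exact: uv_tdelta.
(* [tdelta w'] has scalar 1 at [w], hence on all of [y], but doubles the coordinate at [w']. *)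
have y0 w' : w' != w -> pv y w' = 0%R.
  move=> ww'; apply/eqP; have [k [kv _]] := scal _ (Ttd w').
  have := kv w'; rewrite (kE _ _ (kv w)) !tdE eqxx eq_sym (negbTE ww') mul1r.
  by move/eqP; rewrite -subr_eq0 mulr2n mulrDl mul1r addrK.
(* The test element is taken at an end of the pair other than [w]: the scalar on [y] is 1, yet the
   coordinate of the pair doubles. *)
have b0 u u' : pe y u u' = 0%R.
  have [<-|uu'] := eqVneq u u'; first by rewrite (Hy u u).2 // e_irr.
  have [u'w|u'w] := eqVneq u' w.
    have [k [kv ke]] := scal _ (Ttd u); have := ke u u'.
    rewrite (kE _ _ (kv w)) !tdE eqxx -u'w [u' == u]eq_sym (negbTE uu') mulr1 mul1r.
    by move/eqP; rewrite -subr_eq0 mulr2n mulrDl mul1r addrK => /eqP.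
  have [k [kv ke]] := scal _ (Ttd u'); have := ke u u'.
  rewrite (kE _ _ (kv w)) !tdE eqxx (negbTE uu') [w == u']eq_sym (negbTE u'w) !mul1r.
  by move/eqP; rewrite -subr_eq0 mulr2n mulrDl mul1r addrK => /eqP.
exists w, (pv y w); split=> //; apply: raagP => [z|u z|z]; rewrite ?raagE ?pty //.
by rewrite /ind; case: eqVneq => [->|/y0->]; rewrite ?mulr1 ?mulr0.
Qed.

Lemma aut_torus_classify : exists (s : {perm V}) (d : gT),
  [/\ graph_aut e s, d \in N & phi * conj_aut N d = relabel_aut F e_sym s].
Proof.
have /fin_all_exists[wf /fin_all_exists[cf Hwc]] := aut_vertex.
(* If [u] and [v] had the same image vertex, then [x_ v] would be a power of [x_ u]. *)
have wf_inj : injective wf.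
  move=> u v uv; have [cu Eu] := Hwc u; have [cv Ev] := Hwc v.
  have [k kE] := F_nat (cf v / cf u)%R.
  have : phi (x_ v) = phi (x_ u ^+ k).
    by rewrite phiX // Eu Ev (vgenX e_sym) uv -kE divfK.
  move/perm_inj/(congr1 (fun m => pv m v)); rewrite (vgenX e_sym) !raagE /ind eqxx !mulr1.
  by case: (eqVneq v u) => [->|_ /eqP] //; rewrite mulr0 oner_eq0.
pose s := perm wf_inj.
have sE v : s v = wf v by rewrite permE.
have cU v : cf v \is a GRing.unit by rewrite unitfE (Hwc v).1.
(* Conjugation by [d] divides the coordinate at [wf v] by [cf v], so the corrected map sends
   generators to generators. *)
pose d : gT := toremb e (fun w => FinRing.unit F (cU (s^-1 w))).
have Td : d \in T := toremb_in e _.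
have Nd := TN Td.
pose psi := phi * conj_aut N d.
have Apsi : psi \in Aut N by rewrite groupM ?conj_aut_Aut.
have psiE n : n \in N -> psi n = phi n ^ d.
  by move=> Nn; rewrite permM conj_autE // Aut_closed.
have psiM : {in N &, {morph psi : x y / x * y}} by exact/morphicP/(Aut_morphic Apsi).
have psix v : psi (x_ v) = x_ (s v).
  rewrite psiE // (Hwc v).2 -sE; apply: (mulgI d); rewrite -conjgC torus_vgen //.
  by rewrite mulr1 /d raagE permK.
have psiT t : t \in T -> psi t \in T.
  by move=> Tt; rewrite psiE ?TN // groupJ // phiT.
(* The weight of [t] at [v] is read off from its relation with [x_ v], which [psi] carries to
   [s v]. *)
have psi_pt t v : t \in T -> pt (psi t) (s v) = pt t v.
  move=> Tt; have [k kE] := F_nat (uv (pt t v)).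
  have h : t * x_ v = x_ v ^+ k * t by rewrite torus_vgen // (vgenX e_sym) kE.
  have psiXk : psi (x_ v ^+ k) = psi (x_ v) ^+ k by rewrite !psiE ?groupX // phiX // conjXg.
  have := congr1 psi h; rewrite !psiM ?groupX ?(TN Tt) // psiXk psix.
  move/(congr1 (fun m => pv m (s v))).
  have /in_torus[h1 _] := psiT _ Tt.
  rewrite !pvM (vgenX e_sym) h1 !raagE /ind eqxx !mulr1 mul1r add0r addr0 -kE.
  exact: uv_inj.
have gs : graph_aut e s.
  move=> u v; apply: negb_inj; apply/idP/idP => h.
    apply/(vgen_comm p_pr p_gt2 pcharF e_sym e_irr u v); apply: (perm_inj (s := psi)).
    rewrite !psiM // !psix.
    exact/(vgen_comm p_pr p_gt2 pcharF e_sym e_irr (s u) (s v)).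
  apply/(vgen_comm p_pr p_gt2 pcharF e_sym e_irr (s u) (s v)).
  rewrite /commute -!psix -!psiM //; congr (psi _).
  exact/(vgen_comm p_pr p_gt2 pcharF e_sym e_irr u v).
exists s, d; split=> //; have Ars := relabel_aut_in F e_sym gs.
have rM : {in N &, {morph relabel_aut F e_sym s : x y / x * y}} by exact/morphicP/(Aut_morphic Ars).
apply: (eq_Aut Apsi Ars) => n Nn.
(* The set where the two automorphisms agree is a subgroup containing [T] and all generators. *)
pose W := [set n in N | psi n == relabel_aut F e_sym s n].
have inW m : (m \in W) = (m \in N) && (psi m == relabel_aut F e_sym s m) by rewrite in_set.
have gW : group_set W.
  apply/group_setP; split=> [|m m'].
    rewrite inW group1 /=; apply/eqP.
    have := morph1 (autm_morphism Apsi); have := morph1 (autm_morphism Ars).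
    by rewrite /= !autmE => -> ->.
  by rewrite !inW => /andP[Nm /eqP hm] /andP[Nm' /eqP hm']; rewrite groupM //= psiM // rM // hm hm'.
have : n \in Group gW.
  apply: (subsetP (raag_torus_gen p_pr p_gt2 pcharF F_nat e_sym e_irr _ _)) Nn.
    apply/subsetP=> t Tt; rewrite inW TN //= relabel_autE ?TN //; apply/eqP.
    have /in_torus[a1 a2] := psiT _ Tt; have /in_torus[a3 a4] := Tt.
    apply: raagP => [v|u v|v]; rewrite !raagE ?a1 ?a2 ?a3 ?a4 //.
    by rewrite -[in LHS](permKV s v) psi_pt.
  by move=> v; rewrite inW xN /= relabel_autE // relabel_vgen psix.
by rewrite inW => /andP[_ /eqP].
Qed.
End TorusPreserving.

Lemma aut_classify (phi : {perm gT}) : phi \in Aut N ->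
  exists s n, [/\ graph_aut e s, n \in N & phi = relabel_aut F e_sym s * conj_aut N n].
Proof.
move=> Aphi; have [x Nx hx] := aut_torus Aphi.
have Aphix : phi * conj_aut N x \in Aut N by rewrite groupM ?conj_aut_Aut.
have [s [d [gs Nd E]]] := aut_torus_classify Aphix hx.
have Nxd : (x * d)^-1 \in N by rewrite groupV groupM.
exists s, (x * d)^-1; split=> //.
rewrite -E -!mulgA -!(morphM (conj_aut_morphism N)) /= ?groupM ?(subsetP (normG _)) //.
by rewrite mulgA mulgV (morph1 (conj_aut_morphism N)) mulg1.
Qed.
End RaagAut2.

(** * Supersolvability, through the series [1], [Z], [U], [N] *)

Section RaagSupersolvable.
Variables (p : nat) (F : finFieldType) (V : finType) (e : rel V).
Hypotheses (p_pr : prime p) (p_gt2 : 2 < p) (pcharF : p \in [pchar F]%R)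
  (F_nat : forall c : F, exists k : nat, c = k%:R%R)
  (e_sym : symmetric e).

Local Notation gT := (raag F e).
Local Notation N := (raag_torus F e_sym).
Local Notation U := (unip F e_sym).
Local Notation Z := (edgesub F e_sym).

Lemma egenX u v (c : F) k : e u v -> egen e u v c ^+ k = egen e u v (k%:R * c)%R.
Proof.
move=> euv; have Ux := subsetP (edgesub_sub F e_sym) _ (egen_in e_sym c euv).
have /in_unip[_ h] := groupX k Ux.
by apply: raagP => [w|i j|w]; rewrite ?h ?(pvX _ _ Ux) ?(peX _ _ _ Ux) ?raagE ?mulr0 ?mulrA.
Qed.

(** [U] centralizes [Z], so only the torus part of [n] acts, by its weight on the edge. *)
Lemma egenJ u v (c : F) (n : gT) :
  egen e u v c ^ n = egen e u v (uv (pt n u)^-1%g * uv (pt n v)^-1%g * c)%R.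
Proof.
apply: (mulgI n); rewrite -conjgC; apply: raagP => [w|i j|w]; rewrite !raagE //; first by ring.
rewrite !xpair_eqE.
have uvV a : uv (pt n a)^-1%g = ((uv (pt n a))^-1)%R by exact: FinRing.val_unitV.
rewrite !uvV /ind.
case: (boolP ((i == u) && (j == v))) => [/andP[/eqP-> /eqP->]|_].
  by case: (_ && _) => /=; rewrite ?subrr ?subr0; field; rewrite !uv_neq0.
case: (boolP ((j == u) && (i == v))) => [/andP[/eqP-> /eqP->]|_] /=.
  by rewrite sub0r; field; rewrite !uv_neq0.
by rewrite subrr; ring.
Qed.

Lemma raag_supersolvable : supersolvable N.
Proof.
have sZU := edgesub_sub F e_sym; have sUN := unip_sub F e_sym.
have nZ := edgesub_normal F e_sym; have nU := unip_normal F e_sym.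
have rZ : cyclic_series N Z.
  apply: (@cyclic_series_ext _ N 1%G Z
    [seq egen e q.1.1 q.1.2 q.2 | q <- enum [pred q : (V * V) * F | e q.1.1 q.1.2]]).
  - exact: cyclic_series1.
  - exact: normal1.
  - exact: normal_sub.
  - by move=> x0 /mapP[q]; rewrite mem_enum inE => eq ->; apply: egen_in.
  - exact: sub1G.
  - move=> M _ HM; apply: (edgesub_gen p_pr p_gt2 pcharF) => u v c euv; apply: HM.
    by apply/mapP; exists ((u, v), c); rewrite ?mem_enum.
  move=> x0 n /mapP[q]; rewrite mem_enum inE => eq -> Nn.
  have [k kE] := F_nat (uv (pt n q.1.1)^-1%g * uv (pt n q.1.2)^-1%g)%R; exists k.
  by rewrite egenJ kE egenX // mulVg.
have rU : cyclic_series N U.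
  apply: (@cyclic_series_ext _ N Z U [seq vgen e q.1 q.2 | q <- enum {: V * F}]) => //.
  - by move=> x0 /mapP[q _ ->]; apply: vgen_in.
  - move=> M sZM HM; apply: unip_gen => // v c; apply: HM.
    by apply/mapP; exists (v, c); rewrite ?mem_enum.
  move=> x0 n /mapP[q _ ->] Nn; have Ux := vgen_in e_sym q.1 q.2.
  have Nx := subsetP sUN _ Ux.
  have [k kE] := F_nat (uv (pt n q.1)^-1%g); exists k.
  have Uk := groupX k Ux; have /in_unip[_ hk] := Uk.
  apply/in_edgesub; split=> [|v|v].
  - by rewrite groupM ?groupV ?groupX ?groupJ.
  - by rewrite !raagE hk !raagE mulVg.
  rewrite !raagE hk (pvX _ _ Ux) raagE -kE !raagE.
  have [->|_] := eqVneq v q.1; first by ring.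
  by rewrite /ind /=; ring.
apply: (cyclic_series_ext rU nU (subxx _) (ys := enum N)) => //.
- by move=> y; rewrite mem_enum.
- by move=> M _ HM; apply/subsetP=> y Ny; apply: HM; rewrite mem_enum.
move=> y n; rewrite mem_enum => Ny Nn; exists 1%N.
rewrite expg1; apply: (subsetP (der1_sub_unip F e_sym)).
exact: mem_commg.
Qed.
End RaagSupersolvable.

(** * A graph with given automorphism group *)

Definition graph_repr (rT : finGroupType) (V : finType) (e : rel V) (rho : rT -> {perm V}) :=
  [/\ {morph rho : g h / g * h}, injective rho, forall g, graph_aut e (rho g)
    & forall s, graph_aut e s -> exists g, s = rho g].

(** On at most two points every permutation is a translation, so the edgeless graph suffices. For
    [s] not a translation, [s 1], [s g] and [g * s 1] would be three points. *)
Lemma graph_repr_small (rT : finGroupType) : #|rT| <= 2 ->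
  exists rho : rT -> {perm rT}, graph_repr (fun _ _ => false) rho.
Proof.
move=> card2; exists (fun g => perm (mulIg g)); split=> //.
- by move=> g h; apply/permP=> x; rewrite permM !permE mulgA.
- by move=> g h /permP/(_ 1); rewrite !permE !mul1g.
move=> s _; exists (s 1); apply/permP=> g; rewrite permE.
have [->|g1] := eqVneq g 1; first by rewrite mul1g.
apply: contraTeq card2 => sg; rewrite -ltnNge.
have u3 : uniq [:: s 1; s g; g * s 1].
  rewrite /= !inE !negb_or sg (inj_eq perm_inj) eq_sym g1 /= andbT eq_sym.
  by rewrite -{2}(mul1g (s 1)) (inj_eq (mulIg _)).
by have := card_uniqP u3 => /= <-; exact: max_card.
Qed.

(* The vertices form [m] copies of [rT], on which [rT] acts by right
   translations.  Copies [i] and [j] are joined by the perfect matching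
   [g |-> w i j * g], or by its complement if [m <= i + j]; then the degree of a
   vertex increases with its copy, so an automorphism preserves each copy.
   As [w 0 j = 1] it acts on all copies by the same map, and this map commutes with
   left translations because the [w 1 j] run through [rT]. *)
Section LargeGraph.
Variables (rT : finGroupType).
Hypothesis n_gt2 : 2 < #|rT|.
Local Notation n := #|rT|.
Local Notation m := (#|rT|.+2).
Local Notation V := (rT * 'I_m)%type.

(** Copies 0 and 1 are reserved, and the labels [w 1 j] list [rT] for [j] from 2 on; hence the
    number [m] of copies. *)
Let w0 (i j : nat) : rT := if i == 1%N then nth 1 (enum rT) (j - 2) else 1.
Let w (i j : 'I_m) : rT := if i < j then w0 i j else if j < i then (w0 j i)^-1 else 1.

Let wV i j : w j i = (w i j)^-1.
Proof. by rewrite /w; case: ltngtP; rewrite ?invgK ?invg1. Qed.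

Let matched (x y : V) := y.1 == w x.2 y.2 * x.1.
Let thr (i j : 'I_m) := m <= i + j.
Let adj (x y : V) := (x != y) && (thr x.2 y.2 (+) matched x y).

Let matched_sym : symmetric matched.
Proof.
move=> x y; rewrite /matched (wV x.2 y.2) -(inj_eq (mulgI (w x.2 y.2)^-1)) mulKg.
exact: eq_sym.
Qed.

Let adj_sym : symmetric adj.
Proof. by move=> x y; rewrite /adj matched_sym /thr addnC eq_sym. Qed.
Let adj_irr : irreflexive adj.
Proof. by move=> x; rewrite /adj eqxx. Qed.

Let deg (x : V) := #|[pred y | adj x y]|.
Let D (i : 'I_m) := \sum_(j < m) (if thr i j then n.-1 else 1%N).

(** [D] also counts a loop at [x], which the rule produces in the copy of [x] exactly when it uses
    the matching there, since [w i i = 1]. *)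
Let degE x : deg x + ~~ thr x.2 x.2 = D x.2.
Proof.
have -> : D x.2 = #|[pred y : V | thr x.2 y.2 (+) matched x y]|.
  rewrite -[RHS]sum1_card [RHS](reindex (fun q : 'I_m * rT => (q.2, q.1))) /=; last first.
    by exists (fun q => (q.2, q.1)) => -[].
  rewrite -(pair_big_dep xpredT (fun j h => thr x.2 j (+) matched x (h, j)) (fun _ _ => 1%N)) /=.
  apply: eq_bigr => j _; rewrite sum1_card.
  have Em : forall h, matched x (h, j) = (h == w x.2 j * x.1) by [].
  case: (thr x.2 j).
    rewrite -(cardC1 (w x.2 j * x.1)); apply: eq_card => h.
    by rewrite !inE /= ?Em.
  rewrite -(card1 (w x.2 j * x.1)); apply: eq_card => h.
  by rewrite !inE /= ?Em.
rewrite (cardD1 x [pred y : V | _]) addnC inE /=; congr (_ + _)%N.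
  by rewrite /matched /w ltnn mul1g eqxx addbT.
by apply: eq_card => y; rewrite !inE /adj eq_sym.
Qed.

Let D_incr (i j : 'I_m) : i < j -> D i < D j.
Proof.
(* Copy [m - j] is joined by the matching to copy [i] and by its complement to copy [j], so its term
   grows from 1 to [n.-1]; no other term decreases. *)
move=> ij; have kP : m - j < m by lia.
rewrite /D (bigD1 (Ordinal kP)) //= [X in _ < X](bigD1 (Ordinal kP)) //=.
rewrite -addSn leq_add //.
  have -> : thr i (Ordinal kP) = false.
    apply/negbTE; rewrite -ltnNge -[X in _ < X](subnKC (ltnW (ltn_ord j))).
    by rewrite ltn_add2r.
  have -> : thr j (Ordinal kP) by rewrite /thr /= subnKC // ltnW.
  by rewrite /= ltn_predRL.
apply: leq_sum => k _; rewrite /thr; case: ifP => [h|_].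
  by rewrite (leq_trans h) // leq_add2r ltnW.
by case: ifP => // _; rewrite ltn_predRL ltnW.
Qed.

Let deg_inj x y : deg x = deg y -> x.2 = y.2.
Proof.
have lt_deg (a b : V) : a.2 < b.2 -> deg a < deg b.
  move=> ab; have := D_incr ab; rewrite -!degE.
  (* The loop correction does not increase with the copy, so [deg] inherits the strict growth of
     [D]. *)
  have thr_le : (~~ thr b.2 b.2 <= ~~ thr a.2 a.2)%N.
    rewrite /thr; case h: (m <= a.2 + a.2); last exact: leq_b1.
    by rewrite (leq_trans h) // leq_add // ltnW.
  by move=> h; have := leq_trans h (leq_add (leqnn _) thr_le); rewrite ltn_add2r.
move=> dxy; have [lt|gt|/ord_inj //] := ltngtP x.2 y.2.
  by have := lt_deg _ _ lt; rewrite dxy ltnn.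
by have := lt_deg _ _ gt; rewrite dxy ltnn.
Qed.

Let rho_inj g : injective (fun x : V => (x.1 * g, x.2)).
Proof. by move=> [a i] [b j] [/mulIg-> ->]. Qed.
Let rho g : {perm V} := perm (@rho_inj g).

Lemma graph_repr_large : symmetric adj /\ irreflexive adj /\ graph_repr adj rho.
Proof.
split=> //; split=> //; split.
- by move=> g h; apply/permP=> x; rewrite permM !permE /= mulgA.
- by move=> g h /permP/(_ (1, ord0)); rewrite !permE /= !mul1g => -[].
- move=> g x y; rewrite /adj (inj_eq perm_inj) !permE /=; congr (_ && (_ (+) _)).
  by rewrite /matched /= mulgA (inj_eq (mulIg _)).
move=> s gs.
have s2 x : (s x).2 = x.2.
  apply: deg_inj; rewrite /deg -(card_image (@perm_inj _ s) [pred y | adj x y]).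
  apply: eq_card => y; apply/idP/imageP => [|[z]]; rewrite !inE.
    by move=> h; exists (s^-1 y); rewrite ?permKV // inE -gs permKV.
  by move=> h ->; rewrite gs.
have s_matched x y : x.2 != y.2 -> matched x y -> matched (s x) (s y).
  move=> xy mxy; have nxy : x != y by apply: contraNneq xy => ->.
  have := gs x y; rewrite /adj (inj_eq perm_inj) nxy !s2 mxy /=.
  by case: thr; case: matched.
pose f g := (s (g, ord0)).1.
have sE g j : s (g, j) = (f g, j).
  rewrite [LHS]surjective_pairing s2 /=; congr (_, _).
  have [->//|j0] := eqVneq j ord0.
  have jgt0 : 0 < j by rewrite lt0n; apply: contra_neq j0 => j0; apply: val_inj.
  have w0j : w ord0 j = 1 by rewrite /w /= jgt0.
  have := @s_matched (g, ord0) (g, j); rewrite /matched !s2 /= w0j !mul1g eqxx.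
  by rewrite eq_sym => /(_ j0 isT)/eqP.
(* Copy [enum_rank c + 2] has label [c] relative to copy 1, so [s] preserves the matching of [1]
   with [c]. *)
have fM c : f c = c * f 1.
  have i1P : 1 < m by [].
  have jP : (enum_rank c).+2 < m by rewrite !ltnS.
  have wij : w (Ordinal i1P) (Ordinal jP) = c.
    by rewrite /w /w0 /= subn2 /= nth_enum_rank.
  have := @s_matched (1, Ordinal i1P) (c, Ordinal jP).
  by rewrite /matched !sE /= wij mulg1 eqxx => /(_ isT isT)/eqP.
exists (f 1); apply/permP=> -[g j]; rewrite permE sE /=.
by rewrite fM.
Qed.
End LargeGraph.

Lemma graph_of_group (rT : finGroupType) :
  exists (V : finType) (e : rel V) (rho : rT -> {perm V}),
    [/\ symmetric e, irreflexive e & graph_repr e rho].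
Proof.
have [small|large] := leqP #|rT| 2.
  have [rho h] := graph_repr_small small.
  by exists rT, (fun _ _ => false), rho.
have [? [? ?]] := graph_repr_large large.
by eexists _, _, _; split; eauto.
Qed.

(** * Outer automorphisms *)

Lemma conj_autJ (gT : finGroupType) (N : {group gT}) (a : {perm gT}) x :
  a \in Aut N -> x \in N -> conj_aut N x ^ a = conj_aut N (a x).
Proof.
move=> Aa Nx; apply: (@eq_Aut _ N); rewrite ?groupJ ?conj_aut_Aut // => y Ny.
have Ny' : a^-1 y \in N by rewrite Aut_closed ?groupV.
rewrite -(permKV a y) permJ !conj_autE ?(Aut_closed Aa) //.
by have := morphJ (autm_morphism Aa) Ny' Nx; rewrite /= autmE.
Qed.

Lemma Inn_normal (gT : finGroupType) (N : {group gT}) : Inn N <| Aut N.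
Proof.
rewrite /normal Aut_conj_aut; apply/subsetP=> a Aa; rewrite inE.
apply/subsetP=> _ /imsetP[_ /morphimP[x NNx Nx ->] ->] /=.
by rewrite conj_autJ // mem_morphim ?(subsetP (normG N)) ?Aut_closed.
Qed.

Section Centerless.
Variables (gT : finGroupType) (N : {group gT}).
Hypothesis Z1 : 'Z(N) = 1.
Let f := restrm_morphism (normG N) (conj_aut_morphism N).
Let injf : 'injm f.
Proof. by apply/subsetP=> x; rewrite ker_restrm ker_conj_aut -/('Z(N)) Z1. Qed.

Lemma isog_Inn : N \isog Inn N.
Proof. by apply/isogP; exists f; rewrite // morphim_restrm setIid. Qed.

Lemma p_elt_conj_aut pi x : x \in N -> pi.-elt (conj_aut N x) = pi.-elt x.
Proof. by move=> Nx; rewrite /p_elt -(order_injm injf Nx). Qed.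
End Centerless.

Section RaagOut.
Variables (p l : nat) (F : finFieldType) (V : finType) (e : rel V).
Variables (rT : finGroupType) (rho : rT -> {perm V}).
Hypotheses (p_pr : prime p) (p_gt2 : 2 < p) (pcharF : p \in [pchar F]%R)
  (F_nat : forall c : F, exists k : nat, c = k%:R%R)
  (cardF : #|F| = p) (e_sym : symmetric e) (e_irr : irreflexive e).
Hypotheses (l_pr : prime l) (two_l : (2%:R ^+ l = 1 :> F)%R).
Hypotheses (p_rT : ~~ (p %| #|rT|)) (l_rT : ~~ (l %| #|rT|)).
Hypothesis (rhoP : graph_repr e rho).

Local Notation gT := (raag F e).
Local Notation N := (raag_torus F e_sym).
Local Notation U := (unip F e_sym).
Local Notation T := (torus F e).
Local Notation A := (Aut N).
Local Notation I := (Inn N).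
Local Notation td := (tdelta e p_pr p_gt2 pcharF).

Let Z1 : 'Z(N) = 1. Proof. exact: (center_raag p_pr p_gt2 pcharF e_sym e_irr). Qed.

Let tdN v : td v \in N. Proof. exact/(subsetP (torus_sub F e_sym))/tdelta_in. Qed.

Lemma tdeltaX v : td v ^+ l = 1.
Proof.
have /in_torus[h1 h2] := groupX l (tdelta_in e p_pr p_gt2 pcharF v).
apply: raagP => [w|u w|w]; rewrite ?raagE // ptX.
apply: uv_inj; rewrite uv1.
have -> k : uv (pt (td v) w ^+ k) = (uv (pt (td v) w) ^+ k)%R.
  by elim: k => [|k IH]; rewrite ?expg0 // expgS exprS uvM IH.
by rewrite uv_tdelta; case: ifP; rewrite // expr1n.
Qed.

Lemma pt_conj (m n : gT) v : pt (m ^ n) v = pt m v.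
Proof. by rewrite !raagE unitF_comm mulgK. Qed.

(** [relabel s] carries [tdelta v] to [tdelta (s v)], and the torus part of the latter determines
    [s v]. *)
Lemma graph_aut_fix s : (forall v, pt (relabel s (td v)) =1 pt (td v)) -> s = 1.
Proof.
move=> h; apply/permP=> v; rewrite perm1.
have := congr1 (@uv F) (h v (s v)); rewrite raagE permK !uv_tdelta eqxx.
by case: eqVneq => // _ /eqP; rewrite two_neq1.
Qed.

Let alpha g := relabel_aut F e_sym (rho g).
Let rho_aut g : graph_aut e (rho g). Proof. by case: rhoP. Qed.
Let alphaM : {in [set: rT] &, {morph alpha : g h / g * h}}.
Proof.
move=> g h _ _; have [rhoM _ _ _] := rhoP.
by rewrite /alpha rhoM relabel_autM.
Qed.
Canonical alpha_morphism := Morphism alphaM.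
Let K := (alpha_morphism @* [set: rT])%G.

(** Inner automorphisms preserve torus parts, so [graph_aut_fix] applies. *)
Let alpha_Inn g : alpha g \in I -> g = 1.
Proof.
move=> /morphimP[n _ Nn E]; have [rhoM rho_inj _ _] := rhoP.
have rho1 : rho 1 = 1 by apply: (mulgI (rho 1)); rewrite -rhoM !mulg1.
apply: rho_inj; rewrite rho1; apply: graph_aut_fix => v w.
by rewrite -(relabel_autE (rho_aut g) (tdN v)) -/(alpha g) E conj_autE // pt_conj.
Qed.

Let injalpha : 'injm alpha_morphism.
Proof.
apply/subsetP=> g; rewrite !inE => /eqP /= h.
by apply/eqP/alpha_Inn; rewrite h group1.
Qed.

Let Aut_sdprod : I ><| K = A.
Proof.
have nIA := Inn_normal N; have sKA : K \subset A.
  by apply/subsetP=> _ /morphimP[g _ _ ->]; apply: relabel_aut_in.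
rewrite sdprodE ?(subset_trans sKA (normal_norm nIA)) //.
  apply/eqP; rewrite eqEsubset mul_subG ?(normal_sub nIA) //=.
  rewrite -normC ?(subset_trans sKA (normal_norm nIA)) //.
  apply/subsetP=> phi.
  move/(aut_classify p_pr p_gt2 pcharF F_nat cardF e_irr) => [s [n [gs Nn ->]]].
  have [_ _ _ /(_ s gs)[g ->]] := rhoP.
  apply: mem_mulg; last by rewrite mem_morphim ?(subsetP (normG N)).
  by apply/morphimP; exists g; rewrite ?in_setT.
apply/trivgP/subsetP=> phi /setIP[Ig /morphimP[g _ _ Eg]].
by rewrite Eg in Ig *; rewrite (alpha_Inn Ig) morph1 inE.
Qed.

Let index_Inn : #|A : I| = #|rT|.
Proof. by rewrite -(index_sdprod Aut_sdprod) /= card_injm // cardsT. Qed.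

Let Inn_unique (H : {group {perm gT}}) : H \subset A -> H \isog N -> H = I.
Proof.
move=> sHA HN; have nIA := Inn_normal N; have NI := isog_Inn Z1.
have HI : H \isog I := isog_trans HN NI.
have solI : solvable I.
  rewrite -(isog_sol NI) (series_sol (unip_normal F e_sym)).
  rewrite (pgroup_sol (unip_pgroup p_pr pcharF e_sym)) abelian_sol //.
  exact/sub_der1_abelian/der1_sub_unip.
have pI' : p.-group I^`(1).
  rewrite /pgroup -(card_isog (isog_der 1 NI)).
  exact: pgroupS (der1_sub_unip F e_sym) (unip_pgroup p_pr pcharF e_sym).
pose pi : nat_pred := [pred q | (q == p) || (q == l)].
have piI' : pi.-group I^`(1) by apply: pi_pgroup pI' _; rewrite inE eqxx.
(* The index of [I] is the order of [rT], which neither [p] nor [l] divides. *)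
have EOpi : 'O_pi(I) = 'O_pi(H).
  apply: (pcore_sub_isog solI piI' nIA _ sHA HI); rewrite index_Inn.
  have rT_gt0 : 0 < #|rT| by rewrite -cardsT cardG_gt0.
  apply/pnatP=> // q q_pr q_rT; rewrite !inE; apply/norP; split.
    by apply: contraTneq q_rT => ->.
  by apply: contraTneq q_rT => ->.
have EOp : 'O_p(I) = 'O_p(H).
  by apply: (pcore_sub_isog solI pI' nIA _ sHA HI); rewrite index_Inn p'natE.
have sHI : H \subset I.
  apply/subsetP=> h Hh; have Ah := subsetP sHA h Hh.
  have [s [n [gs Nn Eh]]] := aut_classify p_pr p_gt2 pcharF F_nat cardF e_irr Ah.
  suff s1 : s = 1.
    have r1 : relabel_aut F e_sym s = 1.
      apply: (mulgI (relabel_aut F e_sym s)); rewrite -relabel_autM // s1 !mulg1 //.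
    by rewrite Eh r1 mul1g mem_morphim ?(subsetP (normG N)).
  apply: graph_aut_fix => v.
  pose c := conj_aut N (td v).
  have Ic : c \in I by rewrite mem_morphim ?(subsetP (normG N)).
  (* Since the order of [tdelta v] divides [l], [c] lies in the common [pi]-core. *)
  have Hc : c \in H.
    rewrite (subsetP (pcore_sub pi H)) // -EOpi.
    rewrite (mem_normal_Hall (Hall_pcore_of_der1 solI piI') (pcore_normal _ _) Ic).
    rewrite (p_elt_conj_aut Z1) // /p_elt.
    apply: (@pnat_dvd _ l); first by rewrite order_dvdn tdeltaX.
    by rewrite pnatE // inE eqxx orbT.
  have : [~ c, h] \in 'O_p(H).
    apply: (subsetP _ _ (mem_commg Hc Hh)); apply: pcore_max (der_normal 1 H).
    by rewrite /pgroup (card_isog (isog_der 1 HI)).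
  rewrite -EOp => Och.
  have Nht : h (td v) \in N by rewrite Aut_closed.
  have Ech : [~ c, h] = conj_aut N ((td v)^-1 * h (td v)).
    rewrite commgEl conj_autJ // (morphM (conj_aut_morphism N)) ?(morphV (conj_aut_morphism N)) //;
    by rewrite ?groupV ?(subsetP (normG N)).
  have Ny : (td v)^-1 * h (td v) \in N by rewrite groupM ?groupV.
  (* The commutator lies in a [p]-group and [U] is the normal Sylow [p]-subgroup of [N]; thus [h]
     preserves the torus part of [td v], and so does its relabelling factor. *)
  have : (td v)^-1 * h (td v) \in U.
    rewrite (mem_normal_Hall (unip_Hall p_pr p_gt2 pcharF cardF e_sym) (unip_normal _ _) Ny).
    by rewrite -(p_elt_conj_aut Z1) // -Ech (mem_p_elt (pcore_pgroup p I)).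
  move=> /in_unip[_ hy] w; have := hy w.
  rewrite ptM ptV Eh permM relabel_autE // conj_autE ?relabel_in // pt_conj => hw.
  by apply: (mulgI (pt (td v) w)^-1); rewrite hw mulVg.
by apply/group_inj/eqP; rewrite eqEcard sHI (card_isog HI) leqnn.
Qed.

Lemma raag_torus_Out :
  [/\ [set: rT] \isog A / I,
      'Z(N) = 1,
      (forall H : {group {perm gT}}, H \subset A -> H \isog N -> H = I),
      (exists s : {morphism (A / I) >-> {perm gT}},
          s @* (A / I) \subset A /\
          (forall x, x \in A / I -> coset I (s x) = x))
    & supersolvable N].
Proof.
have sdA := Aut_sdprod.
split=> //.
- apply: isog_trans (sdprod_isog sdA).
  by apply/isogP; exists alpha_morphism.
- have [nIK isoK] := sdprod_isom sdA; have [injq imq] := isomP isoK.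
  have [_ sKA _ _ _] := sdprod_context sdA.
  pose s := invm_morphism injq.
  have imE : restrm nIK (coset I) @* K = A / I := imq.
  have ss : A / I \subset restrm nIK (coset I) @* K by rewrite imE.
  have liftE x : x \in A / I -> exists2 k, k \in K & x = restrm nIK (coset I) k.
    by rewrite -imE => /morphimP[k Kk _ ->]; exists k.
  exists (restrm_morphism ss s); split.
    apply/subsetP=> _ /morphimP[x _ /liftE[k Kk ->] ->] /=.
    by rewrite /restrm invmE // (subsetP sKA).
  by move=> x /liftE[k Kk ->] /=; rewrite /restrm invmE.
exact: (raag_supersolvable p_pr p_gt2 pcharF F_nat e_sym).
Qed.
End RaagOut.

(** * The choice of the two primes *)

Lemma exists_primes (n : nat) : exists p l : nat,
  [/\ prime p, prime l, n < l < p, 2 < p & (2%:R ^+ l = 1 :> 'F_p)%R].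
Proof.
have [l nl l_pr] := prime_above n.
have l_gt1 := prime_gt1 l_pr.
have lt2 : 1 < 2 ^ l - 1.
  by rewrite ltn_subRL (@leq_trans (2 ^ 2)) // leq_exp2l.
pose p := pdiv (2 ^ l - 1); have p_pr : prime p := pdiv_prime lt2.
have p_dvd : p %| 2 ^ l - 1 := pdiv_dvd _.
have pow : (2%:R ^+ l = 1 :> 'F_p)%R.
  have E : (2 ^ l = (2 ^ l - 1) + 1)%N by rewrite subnK // expn_gt0.
  rewrite -natrX E natrD (_ : ((2 ^ l - 1)%:R = 0 :> 'F_p)%R) ?add0r //.
  by apply/eqP; rewrite -(dvdn_pcharf (pchar_Fp p_pr)).
have p_gt2 : 2 < p.
  rewrite ltn_neqAle prime_gt1 // andbT; apply: contraTneq p_dvd => <-.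
  by rewrite dvdn2 oddB ?expn_gt0 // oddX; case: l l_gt1 {nl l_pr lt2 p p_pr pow}.
have two_unit : (2%:R : 'F_p)%R \is a GRing.unit.
  by rewrite unitfE -(dvdn_pcharf (pchar_Fp p_pr)) gtnNdvd.
pose u : {unit 'F_p} := FinRing.unit 'F_p two_unit.
exists p, l; split=> //; rewrite nl /=.
(* The order divides the prime [l] and is not 1, as 2 differs from 1; so [l] divides [p - 1], which
   gives [l < p]. *)
have ou : #[u] = l.
  have ul : u ^+ l = 1 by apply: val_inj; rewrite FinRing.val_unitX.
  have /primeP[_ /(_ #[u])] := l_pr; rewrite order_dvdn ul eqxx => /(_ isT)/orP[|/eqP //].
  rewrite order_eq1 => /eqP/(congr1 val) /= h.
  have : (2%:R - 1 == 0 :> 'F_p)%R by rewrite subr_eq0 h.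
  by rewrite mulrSr addrK oner_eq0.
have : #[u] %| #|[set: {unit 'F_p}]| by rewrite order_dvdG ?inE.
rewrite ou card_finField_unit card_Fp // => /dvdn_leq.
by have := prime_gt1 p_pr; lia.
Qed.

Theorem theorem4p2 (gT : finGroupType) (G : {group gT}) :
  exists (nT : finGroupType) (N : {group nT}),
    [/\ G \isog (Aut N / Inn N),
        'Z(N) = 1,
        (forall H : {group {perm nT}}, H \subset Aut N -> H \isog N -> H = Inn N),
        (exists s : {morphism (Aut N / Inn N) >-> {perm nT}},
            s @* (Aut N / Inn N) \subset Aut N /\
            (forall x, x \in Aut N / Inn N -> coset (Inn N) (s x) = x))
      & supersolvable N].
Proof.
(* The graph lemma takes a whole group type, so [G] is replaced by [subg_of G]. *)
have [V [e [rho [e_sym e_irr rhoP]]]] := graph_of_group (subg_of G).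
have [p [l [p_pr l_pr /andP[lG lp] p_gt2 two_l]]] := exists_primes #|{: subg_of G}|.
have card_gt0 : 0 < #|{: subg_of G}| by rewrite -cardsT cardG_gt0.
have F_nat (c : 'F_p) : exists k : nat, c = k%:R%R by exists (nat_of_ord c); rewrite natr_Zp.
have [GI Z1 uniqI splitI ss] :=
  raag_torus_Out p_pr p_gt2 (pchar_Fp p_pr) F_nat (card_Fp p_pr) e_sym e_irr l_pr two_l
    (negbT (gtnNdvd card_gt0 (ltn_trans lG lp))) (negbT (gtnNdvd card_gt0 lG)) rhoP.
exists (raag 'F_p e), (raag_torus 'F_p e_sym); split=> //.
exact: isog_trans (isog_subg G) GI.
Qed.
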